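(* Let $q\in(0,1)$, $n\in\mathbb{N}$, $a,b\in\mathbb{R}$ with $0<aq<1$, and let $q^2\le t_1,t_2\le 1$ be such that $t_1t_2\ne1$. Then: (i) for $0\le qb<1$, $$p_n(x;a,t_1b)\prec p_n(x;t_2a,b);$$ (ii) for $b<0$, $$p_n(x;a,b)\prec p_n(x;a,t_1b).$$
   Context: For $c\in\mathbb{C}$ and an integer $j\ge0$, $(c;q)_0:=1$ and $(c;q)_j:=\prod_{i=0}^{j-1}(1-cq^i)$. The little $q$-Jacobi polynomial of degree $n$ with parameters $a,b\in\mathbb{R}$ is $$p_n(x;a,b)=p_n(x;a,b|q):=\sum_{j=0}^n\frac{(q^{-n};q)_j\,(abq^{n+1};q)_j}{(aq;q)_j\,(q;q)_j}\,(qx)^j .$$ For real-rooted polynomials $p,r$ of the same degree $n$, with zeros listed with multiplicity in increasing order as $\lambda_1\le\dots\le\lambda_n$, strict interlacing $p\prec r$ means $\lambda_1(p)<\lambda_1(r)<\lambda_2(p)<\lambda_2(r)<\dots<\lambda_n(p)<\lambda_n(r)$.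
   Formalization: Part (i) additionally excludes the case b = 0 with t_2 = 1, and part (ii) additionally assumes t_1 ≠ 1; in the excluded cases the two polynomials coincide, so strict interlacing fails for n ≥ 1. *)

(* Defs.v *)
From mathcomp Require Import all_boot all_order all_algebra.
From mathcomp Require Import reals.

Set Implicit Arguments.
Unset Strict Implicit.
Unset Printing Implicit Defensive.

Import Order.TTheory GRing.Theory Num.Theory.
Local Open Scope ring_scope.

Definition qpoch (A : pzRingType) (c q : A) (j : nat) : A :=
  \prod_(i < j) (1 - c * q ^+ i).

Definition little_qJacobi (R : realType) (q : R) (n : nat) (a b : R) :
    {poly R} :=
  \sum_(j < n.+1)
    (qpoch (q ^- n) q j * qpoch (a * b * q ^+ n.+1) q j
       / (qpoch (a * q) q j * qpoch q q j)) *: (q *: 'X) ^+ j.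

(* p has degree n, all its zeros are real, and s lists them with multiplicity
   in increasing order; [size] of a polynomial is its degree plus one. *)
Definition zeros_listing (R : realType) (n : nat) (p : {poly R}) (s : seq R) :
    Prop :=
  [/\ size p = n.+1, size s = n, sorted <=%R s
    & p = lead_coef p *: \prod_(z <- s) ('X - z%:P)].

Definition strictly_interlaces (R : realType) (n : nat) (p r : {poly R}) :
    Prop :=
  exists s t : seq R,
    [/\ zeros_listing n p s, zeros_listing n r t,
        (forall i : nat, (i < n)%N -> s`_i < t`_i)
      & (forall i : nat, (i.+1 < n)%N -> t`_i < s`_i.+1)].

(* Main.v *)
Require Import Defs.
From mathcomp Require Import all_boot all_order all_algebra.
From mathcomp Require Import reals.
From mathcomp Require Import boolp classical_sets functions topology normedtype.
From mathcomp Require Import sequences.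
From mathcomp Require Import ring lra zify.

(** The polynomial p_n(x; a, b) is orthogonal to all polynomials of lower
    degree for the measure that puts the mass
    w_k = (aq)^k (bq; q)_k / (q; q)_k at the point q^k, for every k >= 0
    ([jacobi_orthogonal]): the moments come from the two-term recurrence of
    w ([moment]), and the sums to be killed vanish by the finite q-binomial
    theorem ([q_binomial_annihilates]).  As w is positive, p_n has n simple
    zeros in (0, 1) ([orthogonal_poly_zeros]) and Gauss quadrature holds at
    these zeros ([quadrature]).

    Interlacing then follows from an inertia argument in the style of
    Courant and Fischer, which replaces the differentiation with respect to a
    parameter in Markov's theorem.  Let al and be be the zeros attached to two
    measures A and B, let M and N be polynomials of degree at most d, and
    suppose that M^2 A / (N^2 B) increases with x on the points q^k.  If
    al_(i+d) <= be_i =: c, take the polynomial h of degree n - 1 - d that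
    vanishes at be_j for j < i and at al_j for j > i + d.  Quadrature for A
    and for B gives
      int (x - c) (M h)^2 dA <= 0 <= int (x - c) (N h)^2 dB.
    But (x - c) (M^2 A - W N^2 B) >= 0 at all points q^k, if W is the value
    of the ratio where x crosses c.  Hence both integrals (the second one
    multiplied by W) are equal and zero, which cannot be if the ratio
    increases strictly, or if d > 0 and M has no zero among the al_j.  So
    be_i < al_(i+d) ([zeros_lt]).

    Used with d = 0, M = N = 1 this compares zeros of the same rank; used with
    d = 1 it compares a zero of the second polynomial with the next zero of
    the first one.  In the latter case (M, N) is (x, 1 - bqx) for part (i) and
    (1 - bqx, 1) for part (ii).  At t1 = t2 = q^2 the parameter shifts
    multiply the weights, up to constants, by x^2 and by
    (1 - bqx)(1 - bq^2x), and the latter is close enough to the square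
    (1 - bqx)^2; this is where the bound q^2 <= t1, t2 comes from. *)

Set Implicit Arguments.
Unset Strict Implicit.
Unset Printing Implicit Defensive.

Import Order.TTheory GRing.Theory Num.Theory.
Import numFieldNormedType.Exports.
Local Open Scope ring_scope.

(** * Series with nonnegative terms *)

Section Series.
Variable R : realType.
Implicit Types (u w : nat -> R) (f g : {poly R}).

Lemma ratio_test w (r : R) (K : nat) : 0 < r < 1 -> (forall k, 0 <= w k) ->
  (forall k, (K <= k)%N -> w k.+1 <= r * w k) -> cvgn (series w).
Proof.
move=> /andP[r0 r1] w0 wr.
(* C bounds w j / r ^+ j for j <= K; the ratio extends the bound to all j. *)
pose C := \sum_(j < K.+1) w j / r ^+ j.
have wC k : w k <= C * r ^+ k.
  have [kK|] := leqP k K.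
    rewrite -ler_pdivrMr ?exprn_gt0// /C (bigD1 (Ordinal (kK : (k < K.+1)%N)))//=.
    by rewrite lerDl sumr_ge0// => j _; rewrite divr_ge0// exprn_ge0// ltW.
  elim: k => // k IH; rewrite ltnS leq_eqVlt => /predU1P[<-|Kk].
    apply: le_trans (wr _ (leqnn K)) _.
    rewrite exprS mulrCA ler_pM2l// -ler_pdivrMr ?exprn_gt0// /C big_ord_recr/=.
    by rewrite lerDr sumr_ge0// => j _; rewrite divr_ge0// exprn_ge0// ltW.
  apply: le_trans (wr _ (ltnW Kk)) _.
  by rewrite exprS mulrCA ler_pM2l// IH.
apply: (@series_le_cvg _ _ (geometric C r)) => //.
- by move=> k /=; apply: le_trans (w0 k) (wC k).
- by apply: is_cvg_geometric_series; rewrite ger0_norm// ltW.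
Qed.

Lemma nneg_series_lim_le0 u : cvgn (series u) -> (forall k, 0 <= u k) ->
  limn (series u) <= 0 -> forall k, u k = 0.
Proof.
move=> cu u0 lu k; apply/eqP; rewrite eq_le u0 andbT.
have nd : nondecreasing_seq (series u) by apply: nondecreasing_series.
have := nondecreasing_cvgn_le nd cu k.+1; rewrite /series /= big_nat_recr//=.
move=> h; have : \sum_(0 <= i < k) u i + u k <= 0 by apply: le_trans h lu.
by apply: le_trans; rewrite lerDr sumr_ge0.
Qed.

Lemma lim_series_ge0 u : cvgn (series u) -> (forall k, 0 <= u k) ->
  0 <= limn (series u).
Proof.
move=> cu u0; apply: limr_ge => //; apply: nearW => n.
by rewrite /series/= sumr_ge0.
Qed.

End Series.

(** * Real roots and signs of polynomials *)

Section RealFactorization.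
Variable R : realType.
Implicit Types (p h : {poly R}).

(** Such a polynomial keeps the sign of [h.[0]], by the intermediate value
    theorem. *)
Lemma no_root_sign h : (forall x, ~~ root h x) ->
  exists2 e : R, e != 0 & forall x, 0 < e * h.[x].
Proof.
move=> nr; exists h.[0] => [|x]; first exact: nr.
rewrite lt_neqAle eq_sym mulf_eq0 negb_or (nr 0) (nr x)/= leNgt.
apply/negP => hx.
have ivt a b : a <= b -> h.[a] * h.[b] < 0 -> False.
  move=> ab hab.
  have [] := @poly_ivt _ (- h.[a] *: h) a b ab.
    rewrite !hornerZ; apply/andP; split.
      by rewrite mulNr oppr_le0 -expr2 sqr_ge0.
    by rewrite mulNr oppr_ge0 ltW.
  move=> y _; rewrite rootZ ?(negPf (nr y))// oppr_eq0.
  by apply/eqP => h0; move: hab; rewrite h0 mul0r ltxx.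
by have [/ivt|/ltW/ivt] := leP 0 x; apply=> //; rewrite mulrC.
Qed.

Lemma real_factor p : p != 0 ->
  exists s h, p = \prod_(z <- s) ('X - z%:P) * h /\ forall x, ~~ root h x.
Proof.
have [m] := ubnP (size p); elim: m p => // m IH p pm p0.
have [[x /factor_theorem[g pg]]|nr] := pselect (exists x, root p x); last first.
  exists [::], p; rewrite big_nil mul1r; split=> // x; apply/negP => px.
  by apply: nr; exists x.
have g0 : g != 0 by apply: contra_neq p0; rewrite pg => ->; rewrite mul0r.
have [|s [h [gs hr]]] := IH g _ g0.
  by move: pm; rewrite pg size_Mmonic ?monicXsubC// size_XsubC addn2.
exists (x :: s), h; split=> //; rewrite big_cons pg gs; ring.
Qed.

(** The list [s'] keeps each zero of [s] in (0, 1) that has odd multiplicity: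
    these are the places where the product changes sign on (0, 1], so
    multiplying by their product leaves a constant sign [e]. *)
Lemma odd_sign_changes (s : seq R) : exists (s' : seq R) (e : R),
  [/\ uniq s', {subset s' <= s}, all (fun z => 0 < z < 1) s', e != 0
    & forall x, 0 < x <= 1 ->
     0 <= e * ((\prod_(z <- s) ('X - z%:P)).[x] * (\prod_(z <- s') ('X - z%:P)).[x])].
Proof.
elim: s => [|z s [s' [e [us' ss' s01 e0 hs]]]].
  by exists [::], 1; split=> // [|x _]; rewrite ?oner_eq0// !big_nil hornerC !mul1r.
have sub1 : {subset s' <= z :: s} by move=> y /ss'; rewrite inE orbC => ->.
have [z0|z0] := leP z 0.
  exists s', e; split=> // x x01; rewrite big_cons hornerM hornerXsubC.
  rewrite -mulrA mulrCA mulr_ge0 ?hs//.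
  by rewrite subr_ge0 (le_trans z0)// ltW//; case/andP: x01.
have [z1|z1] := leP 1 z.
  exists s', (- e); split=> //; rewrite ?oppr_eq0// => x x01.
  rewrite big_cons hornerM hornerXsubC mulNr -mulrN -!mulNr opprB.
  rewrite -mulrA mulrCA mulr_ge0 ?hs//.
  by rewrite subr_ge0 (le_trans _ z1)//; case/andP: x01.
have [zs|zs] := boolP (z \in s').
  exists (rem z s'), e; split=> //; rewrite ?rem_uniq//.
  - by move=> y /mem_rem/sub1.
  - by apply/allP => y /mem_rem/(allP s01).
  move=> x /hs; rewrite big_cons (perm_big _ (perm_to_rem zs)) big_cons !hornerM.
  by rewrite [X in e * X]mulrCA mulrA.
exists (z :: s'), e; split=> //=; rewrite ?zs ?us' ?z0 ?z1//.
  by move=> y; rewrite !inE => /predU1P[->|/ss' ->]; rewrite ?eqxx ?orbT.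
move=> x /hs h; rewrite !big_cons !hornerM.
set A := _.[x] in h *; set B := _.[x] in h *; set C := _.[x].
have -> : e * (C * A * (C * B)) = C ^+ 2 * (e * (A * B)) by ring.
by rewrite mulr_ge0 ?sqr_ge0.
Qed.

End RealFactorization.

(** * Integration against point masses at the powers of q *)

Section QIntegral.
Variables (R : realType) (q : R).
Hypothesis hq : 0 < q < 1.
Implicit Types (w : nat -> R) (f g h p : {poly R}).

Let q0 : 0 < q. Proof. by case/andP: hq. Qed.
Let q1 : q < 1. Proof. by case/andP: hq. Qed.

Lemma qexp01 k : 0 < q ^+ k <= 1.
Proof. by rewrite exprn_gt0// exprn_ile1// ltW. Qed.

Lemma qexp_inj : injective (GRing.exp q).
Proof. by apply: ieexprIn => //; rewrite lt_eqF. Qed.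

(** A tail of the sequence q^k already has infinitely many points. *)
Lemma poly_qexp_eq0 f (K : nat) : (forall k, (K < k)%N -> f.[q ^+ k] = 0) -> f = 0.
Proof.
move=> f0; pose rs := [seq q ^+ k | k <- iota K.+1 (size f)].
apply: (@roots_geq_poly_eq0 _ f rs); last by rewrite size_map size_iota.
  apply/allP => y /mapP[k]; rewrite mem_iota => /andP[Kk _] ->.
  by apply/rootP/f0.
by rewrite map_inj_uniq ?iota_uniq//; apply: qexp_inj.
Qed.

Definition qint w f : R := limn (series (fun k => w k * f.[q ^+ k])).

Section OneWeight.
Variable w : nat -> R.
Hypotheses (w_gt0 : forall k, 0 < w k) (w_cvg : cvgn (series w)).

Lemma qint_cvg f : cvgn (series (fun k => w k * f.[q ^+ k])).
Proof.
have [M fM] := poly_itv_bound f 0 1.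
apply: normed_cvg; apply: (@series_le_cvg _ _ (fun k => M * w k)).
- by move=> k; rewrite normr_ge0.
- move=> k; rewrite /= mulr_ge0 ?(ltW (w_gt0 _))//.
  by apply: le_trans (fM 0 _); rewrite ?normr_ge0// lexx ler01.
- move=> k /=; rewrite normrM (gtr0_norm (w_gt0 k)) mulrC ler_pM2r//.
  by apply: fM; case/andP: (qexp01 k) => /ltW -> ->.
- exact: (@is_cvg_seriesZ _ w M w_cvg).
Qed.

Lemma qintD f g : qint w (f + g) = qint w f + qint w g.
Proof.
rewrite /qint -lim_seriesD; [|exact: qint_cvg..].
by congr (limn (series _)); apply/funext => k /=; rewrite hornerD mulrDr.
Qed.

Lemma qintZ c f : qint w (c *: f) = c * qint w f.
Proof.
rewrite /qint -[c * _]/(c *: (_ : R^o)) -lim_seriesZ; last exact: qint_cvg.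
by congr (limn (series _)); apply/funext => k /=; rewrite hornerZ mulrCA.
Qed.

Lemma qint0 : qint w 0 = 0.
Proof. by rewrite -(scale0r 0) qintZ mul0r. Qed.

Lemma qint_sum I (r : seq I) (F : I -> {poly R}) :
  qint w (\sum_(i <- r) F i) = \sum_(i <- r) qint w (F i).
Proof. exact: (big_morph (qint w) qintD qint0). Qed.

Lemma qint_le0_eq0 f : (forall k, 0 <= f.[q ^+ k]) -> qint w f <= 0 -> f = 0.
Proof.
move=> f0 mf; apply: (@poly_qexp_eq0 f 0) => k _.
have h j : 0 <= w j * f.[q ^+ j] by rewrite mulr_ge0// ltW.
have /eqP := nneg_series_lim_le0 (@qint_cvg f) h mf k.
by rewrite mulf_eq0 gt_eqF//= => /eqP.
Qed.

Definition orthogonal_poly n p :=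
  size p = n.+1 /\ (forall g, (size g <= n)%N -> qint w (p * g) = 0).

(** If fewer than n zeros in (0, 1) had odd multiplicity, their product [g]
    would be a test polynomial for which [p * g] has a constant sign at all
    points q^k, against orthogonality. *)
Lemma orthogonal_poly_zeros n p : orthogonal_poly n p ->
  exists s, [/\ zeros_listing n p s, sorted <%R s & all (fun z => 0 < z < 1) s].
Proof.
move=> [sp op]; have p0 : p != 0 by rewrite -size_poly_gt0 sp.
have [s [h [ps hr]]] := real_factor p0.
have [e1 e10 hh] := no_root_sign hr.
have [s' [e [us' ss' s01 e0 hs]]] := odd_sign_changes s.
pose g := \prod_(z <- s') ('X - z%:P).
have ss'n : (n <= size s')%N.
  rewrite leqNgt; apply/negP => lt.
  have : (e * e1) *: (p * g) = 0.
    apply: qint_le0_eq0; last by rewrite qintZ op ?mulr0// size_prod_XsubC.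
    move=> k; rewrite hornerZ ps !hornerM.
    have := hs _ (qexp01 k); have /ltW := hh (q ^+ k).
    set A := _.[_]; set B := _.[_]; set C := _.[_] => h1 h2.
    have -> : e * e1 * (B * A * C) = (e1 * A) * (e * (B * C)) by ring.
    by rewrite mulr_ge0.
  move/eqP; rewrite scaler_eq0 !mulf_eq0 (negPf e0) (negPf e10) (negPf p0)/=.
  by apply/negP/monic_neq0/monic_prod_XsubC.
have rs' : all (root p) s'.
  by apply/allP => z /ss' zs; rewrite ps rootM root_prod_XsubC zs.
have s'n : size s' = n.
  by apply/eqP; rewrite eqn_leq ss'n andbT -ltnS -sp max_poly_roots.
exists (sort <=%R s').
have srt : sorted <%R (sort <=%R s') by rewrite sort_lt_sorted.
split=> //; last by rewrite all_sort.
split=> //; rewrite ?size_sort//.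
  exact: sort_le_sorted.
rewrite (perm_big s') ?perm_sort//=.
by apply: all_roots_prod_XsubC; rewrite ?s'n// uniq_rootsE.
Qed.

End OneWeight.
End QIntegral.

(** * Gauss quadrature and comparison of zeros *)

Section Quadrature.
Variables (R : realType) (q : R).
Hypothesis hq : 0 < q < 1.
Implicit Types (w : nat -> R) (f g h p : {poly R}).

(** With L_z the product of the (X - y) over the other zeros y, the weight is
    the integral of (L_z / L_z(z))^2, hence positive.  The difference between f
    and its interpolation by these squares vanishes at the zeros, so it is p
    times a polynomial of degree less than n, and integrates to 0. *)
Lemma quadrature w n p s : (forall k, 0 < w k) -> cvgn (series w) ->
  orthogonal_poly q w n p -> zeros_listing n p s -> uniq s ->
  exists2 c : R -> R, (forall z, z \in s -> 0 < c z)
    & forall f, (size f <= n + n)%N -> qint q w f = \sum_(z <- s) c z * f.[z].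
Proof.
move=> w0 wc [sp op] [_ ss _ ps] us.
pose L z := \prod_(y <- rem z s) ('X - y%:P).
have L0 y z : y \in s -> y != z -> (L z).[y] = 0.
  move=> ys yz; apply/rootP; rewrite root_prod_XsubC.
  by rewrite mem_rem_uniq// inE yz ys.
have Lz z : (L z).[z] != 0.
  by rewrite -/(root _ _) root_prod_XsubC mem_rem_uniqF.
exists (fun z => qint q w (L z ^+ 2) / (L z).[z] ^+ 2) => [z zs|f fn].
  rewrite divr_gt0//; last by rewrite exprn_even_gt0/=.
  rewrite ltNge; apply/negP => /(qint_le0_eq0 hq w0 wc) L20.
  have /eqP : L z ^+ 2 = 0 by apply: L20 => k; rewrite horner_exp sqr_ge0.
  by rewrite expf_eq0/=; apply/negP/monic_neq0/monic_prod_XsubC.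
(* S interpolates f at the zeros by squares, instead of the usual L_z. *)
pose S := \sum_(z <- s) (f.[z] / (L z).[z] ^+ 2) *: L z ^+ 2.
have Sz y : y \in s -> S.[y] = f.[y].
  move=> ys; rewrite /S horner_sum (bigD1_seq y)//= big1_seq ?addr0.
    by rewrite hornerZ horner_exp divfK// expf_neq0.
  move=> z /andP[zy zs]; rewrite hornerZ horner_exp (L0 y z ys) 1?eq_sym//.
  by rewrite expr0n/= mulr0.
have mS : qint q w S = \sum_(z <- s) qint q w (L z ^+ 2) / (L z).[z] ^+ 2 * f.[z].
  rewrite qint_sum//; apply: eq_bigr => z _; rewrite qintZ//; ring.
rewrite -mS -[f in LHS](subrK S) qintD//.
suff -> : qint q w (f - S) = 0 by rewrite add0r.
have sS : (size S <= n + n)%N.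
  apply: (leq_trans (size_sum _ _ _)); apply/bigmax_leqP_seq => z zs _.
  apply: (leq_trans (size_scale_leq _ _)); apply: (leq_trans (size_polyMleq _ _)).
  rewrite size_prod_XsubC size_rem// ss; case: n ss {sp op ps fn} => [/size0nil s0|m _].
    by rewrite s0 in zs.
  by rewrite /=; lia.
have : \prod_(z <- s) ('X - z%:P) %| f - S.
  apply: uniq_roots_dvdp; rewrite ?uniq_rootsE//.
  by apply/allP => z zs; rewrite rootE hornerD hornerN Sz// subrr.
have p0 : p != 0 by rewrite -size_poly_gt0 sp.
rewrite -(dvdpZl _ _ (_ : lead_coef p != 0)) ?lead_coef_eq0// -ps.
move=> /dvdpP[k fk]; rewrite fk mulrC op//.
have [->|k0] := eqVneq k 0; first by rewrite size_poly0.
have : (size (f - S)%R <= n + n)%N.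
  by apply: (leq_trans (size_polyD _ _)); rewrite size_polyN geq_max fn.
by rewrite fk size_mul// sp addnS/= leq_add2r.
Qed.

Lemma exists_qexp_lt (e : R) : 0 < e -> exists k, q ^+ k < e.
Proof.
move=> e0; case/andP: hq => q0 q1.
have /cvgrPdist_lt/(_ e e0)[K _ /(_ K (leqnn K))] :
    (GRing.exp q @ \oo --> (0 : R))%classic.
  by apply: cvg_expr; rewrite ger0_norm// ltW.
by rewrite sub0r normrN ger0_norm ?exprn_ge0 ?(ltW q0)// => h; exists K.
Qed.

(** The constant W is the value of the ratio [rho] at the largest point q^K
    that is at most c.  As [rho] increases with x = q^k, the factors x - c and
    rho - W never have opposite signs, so that the difference of the two
    integrals is a series of nonnegative terms.  If it vanishes and [rho] is
    strict, h is zero at all points q^k with k > K. *)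
Lemma qint_compare (A B : nat -> R) (M N h : {poly R}) (c : R)
    (rho := fun k => (M.[q ^+ k] ^+ 2 * A k) / (N.[q ^+ k] ^+ 2 * B k)) :
  (forall k, 0 < A k) -> cvgn (series A) ->
  (forall k, 0 < B k) -> cvgn (series B) ->
  (forall k, N.[q ^+ k] != 0) -> 0 < c ->
  (forall k, rho k.+1 <= rho k) ->
  exists W : R, [/\ 0 <= W,
    W * qint q B (('X - c%:P) * (N * h) ^+ 2)
      <= qint q A (('X - c%:P) * (M * h) ^+ 2)
  & (forall k, rho k.+1 < rho k) ->
      qint q A (('X - c%:P) * (M * h) ^+ 2)
        <= W * qint q B (('X - c%:P) * (N * h) ^+ 2) -> h = 0].
Proof.
move=> A0 Ac B0 Bc N0 c0 rhoS; case/andP: (hq) => q0 q1.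
have ex : exists k, q ^+ k <= c.
  by have [k /ltW] := exists_qexp_lt c0; exists k.
pose K := ex_minn ex.
have [Kc Kmin] : q ^+ K <= c /\ forall k, (k < K)%N -> c < q ^+ k.
  rewrite /K; case: ex_minnP => m mc min; split=> // k km.
  by rewrite ltNge; apply: contraL km => /min; rewrite -leqNgt.
have rho_ni j k : (j <= k)%N -> rho k <= rho j.
  elim: k => [|k IH]; first by rewrite leqn0 => /eqP ->.
  by rewrite leq_eqVlt => /predU1P[->//|/IH]; apply: le_trans.
have NB k : 0 < N.[q ^+ k] ^+ 2 * B k.
  by rewrite mulr_gt0// exprn_even_gt0/=.
have rhoE k : M.[q ^+ k] ^+ 2 * A k = rho k * (N.[q ^+ k] ^+ 2 * B k).
  by rewrite /rho divfK// gt_eqF.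
pose W := rho K.
have W0 : 0 <= W.
  by rewrite /W /rho divr_ge0 ?(ltW (NB _))// mulr_ge0 ?sqr_ge0// ltW.
pose u k := (q ^+ k - c) * (rho k - W) * (N.[q ^+ k] ^+ 2 * B k) * h.[q ^+ k] ^+ 2.
have u0 k : 0 <= u k.
  rewrite /u mulr_ge0 ?sqr_ge0// mulr_ge0 ?(ltW (NB _))//.
  have [Kk|kK] := leqP K k.
    rewrite mulr_le0// subr_le0 ?rho_ni//.
    by apply: le_trans Kc; rewrite ler_iXn2l.
  by rewrite mulr_ge0// subr_ge0; [rewrite ltW// Kmin | rewrite rho_ni// ltnW].
set fA := ('X - c%:P) * (M * h) ^+ 2; set fB := ('X - c%:P) * (N * h) ^+ 2.
pose vA : (R ^nat)%type := fun k => A k * fA.[q ^+ k].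
pose vB : (R ^nat)%type := fun k => B k * (W *: fB).[q ^+ k].
have cA : cvgn (series vA) by exact: qint_cvg.
have cB : cvgn (series vB) by exact: qint_cvg.
have uE : u = vA - vB.
  apply/funext => k.
  transitivity (A k * fA.[q ^+ k] - B k * (W *: fB).[q ^+ k]); last by [].
  rewrite /fA /fB.
  rewrite hornerZ !hornerM hornerXsubC /u.
  move: (rhoE k); set x := _.[_]; set y := _.[_]; set z := _.[_] => e.
  have -> : A k * ((q ^+ k - c) * (x * z * (x * z))) =
    (x ^+ 2 * A k) * (q ^+ k - c) * z ^+ 2 by ring.
  rewrite e; ring.
have cu : cvgn (series u) by rewrite uE; exact: is_cvg_seriesB.
have lu : limn (series u) = qint q A fA - W * qint q B fB.
  by rewrite uE lim_seriesB// -qintZ.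
exists W; split=> // [|rhoSlt le].
  by rewrite -subr_ge0 -lu lim_series_ge0.
apply: (@poly_qexp_eq0 _ _ hq _ K) => k Kk.
have /eqP : u k = 0 by apply: nneg_series_lim_le0 => //; rewrite lu subr_le0.
rewrite /u !mulf_eq0 (negPf (N0 k)) (gt_eqF (B0 k)) !orbF.
have -> : (q ^+ k - c == 0) = false.
  by rewrite subr_eq0 lt_eqF// (lt_le_trans _ Kc)// ltr_iXn2l.
have -> : (rho k - W == 0) = false.
  rewrite subr_eq0 lt_eqF//; apply: le_lt_trans (rhoSlt K).
  exact: rho_ni.
by rewrite /= => /orP[]/eqP.
Qed.

(** The inertia argument explained at the top of the file.  When d > 0 and the
    ratio is only weakly monotone, the integral over A is 0 and all its
    quadrature terms vanish, so that h, of degree less than n - 1, is zero at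
    all zeros [al] other than c. *)
Lemma zeros_lt (A B : nat -> R) (M N pA pB : {poly R}) (al be : seq R) n d i
    (rho := fun k => (M.[q ^+ k] ^+ 2 * A k) / (N.[q ^+ k] ^+ 2 * B k)) :
  (forall k, 0 < A k) -> cvgn (series A) ->
  (forall k, 0 < B k) -> cvgn (series B) ->
  orthogonal_poly q A n pA -> zeros_listing n pA al -> sorted <%R al ->
  orthogonal_poly q B n pB -> zeros_listing n pB be -> sorted <%R be ->
  (size M <= d.+1)%N -> (size N <= d.+1)%N ->
  all (fun z => 0 < z < 1) be ->
  (forall k, N.[q ^+ k] != 0) ->
  (forall k, rho k.+1 <= rho k) ->
  ((forall k, rho k.+1 < rho k) \/ (0 < d)%N /\ all (fun z => M.[z] != 0) al) ->
  (i + d < n)%N -> be`_i < al`_(i + d).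
Proof.
move=> A0 Ac B0 Bc oA zA sA oB zB sB sM sN be01 N0 rhoS dM idn.
have [_ nA sAle _] := zA; have [_ nB sBle _] := zB.
have uA := lt_sorted_uniq sA; have uB := lt_sorted_uniq sB.
have iN : (i < n)%N := leq_ltn_trans (leq_addr _ _) idn.
rewrite ltNge; apply/negP => le; pose c := be`_i.
have cbe : c \in be by rewrite mem_nth// nB.
have c0 : 0 < c by case/andP: (allP be01 _ cbe).
(* The vanishing of h leaves only zeros al_k <= c and be_k >= c. *)
pose h := \prod_(z <- take i be ++ drop (i + d).+1 al) ('X - z%:P).
have h0 : h != 0 by apply/monic_neq0/monic_prod_XsubC.
have sh : size h = (n - d)%N.
  rewrite size_prod_XsubC size_cat size_drop size_take nA nB iN.
  by clear -idn; lia.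
have size_form (X : {poly R}) : (size X <= d.+1)%N ->
    (size (('X - c%:P) * (X * h) ^+ 2)%R <= n + n)%N.
  move=> sX; have Xh : (size (X * h)%R <= n)%N.
    apply: leq_trans (size_polyMleq _ _) _; rewrite sh.
    by move: (size X) sX => x; clear -idn; lia.
  apply: leq_trans (size_polyMleq _ _) _; rewrite size_XsubC /=.
  apply: (@leq_trans (n + n).-1.+1); last by clear -idn; lia.
  rewrite ltnS (leq_trans (size_polyMleq _ _))//.
  by move: (size _) Xh => x; clear -idn; lia.
have [cA cA0 qA] := quadrature A0 Ac oA zA uA.
have [cB cB0 qB] := quadrature B0 Bc oB zB uB.
have tA z : z \in al -> (z - c) * (M * h).[z] ^+ 2 <= 0.
  rewrite -{1}(cat_take_drop (i + d).+1 al) mem_cat => /orP[zt|zd].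
    rewrite mulr_le0_ge0 ?sqr_ge0// subr_le0 (le_trans _ le)//.
    have /(nthP 0)[j] := zt; rewrite size_take_min nA leq_min => /andP[ji _] <-.
    by rewrite nth_take// le_sorted_leq_nth ?inE ?nA// (leq_ltn_trans _ idn).
  suff /rootP hz : root h z by rewrite hornerM hz mulr0 expr0n mulr0.
  by rewrite root_prod_XsubC mem_cat zd orbT.
have tB z : z \in be -> 0 <= (z - c) * (N * h).[z] ^+ 2.
  rewrite -{1}(cat_take_drop i be) mem_cat => /orP[zt|zd].
    suff /rootP hz : root h z by rewrite hornerM hz mulr0 expr0n mulr0.
    by rewrite root_prod_XsubC mem_cat zt.
  rewrite mulr_ge0 ?sqr_ge0// subr_ge0.
  have /(nthP 0)[j] := zd; rewrite size_drop nB => jn <-.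
  by rewrite nth_drop le_sorted_leq_nth ?inE ?nB ?leq_addr// -ltn_subRL.
have [W [W0 cmp strict]] := qint_compare h A0 Ac B0 Bc N0 c0 rhoS.
have mB : 0 <= qint q B (('X - c%:P) * (N * h) ^+ 2).
  rewrite qB ?size_form// big_seq sumr_ge0// => z zs.
  by rewrite mulr_ge0 ?(ltW (cB0 _ zs))// hornerM hornerXsubC horner_exp tB.
have mA : qint q A (('X - c%:P) * (M * h) ^+ 2) <= 0.
  rewrite qA ?size_form// big_seq sumr_le0// => z zs.
  by rewrite mulr_ge0_le0 ?(ltW (cA0 _ zs))// hornerM hornerXsubC horner_exp tA.
case: dM => [/strict hs|[d0 M0]].
  by move: h0; rewrite hs ?eqxx// (le_trans mA)// mulr_ge0.
(* Now 0 <= W * int_B <= int_A <= 0. *)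
have mA0 : qint q A (('X - c%:P) * (M * h) ^+ 2) = 0.
  by apply/eqP; rewrite eq_le mA (le_trans _ cmp)// mulr_ge0.
have hz z : z \in rem c al -> root h z.
  rewrite mem_rem_uniq// inE => /andP[zc zs].
  have /eqP := mA0; rewrite qA ?size_form// -oppr_eq0 -sumrN big_seq psumr_eq0.
    move=> /allP/(_ _ zs); rewrite zs /= oppr_eq0 mulf_eq0 (gt_eqF (cA0 _ zs))/=.
    rewrite hornerM hornerXsubC horner_exp mulf_eq0 subr_eq0 (negPf zc)/=.
    by rewrite expf_eq0/= hornerM mulf_eq0 (negPf (allP M0 _ zs)).
  move=> y ys; rewrite oppr_ge0 mulr_ge0_le0 ?(ltW (cA0 _ ys))//.
  by rewrite hornerM hornerXsubC horner_exp tA.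
move/eqP: h0; apply; apply: (@roots_geq_poly_eq0 _ h (rem c al)).
- exact/allP.
- exact: rem_uniq.
- rewrite sh; have [ca|ca] := boolP (c \in al).
    by rewrite size_rem// nA -subn1 leq_sub2l.
  by rewrite rem_id// nA leq_subr.
Qed.

End Quadrature.

(** * The q-binomial theorem *)

Section QPochhammer.
Variables (R : realType) (q : R).
Hypothesis hq : 0 < q < 1.
Implicit Types (a b c y : R) (n m j k : nat).

Let q0 : 0 < q. Proof. by case/andP: hq. Qed.
Let q1 : q < 1. Proof. by case/andP: hq. Qed.

Lemma qpoch0 c : qpoch c q 0 = 1. Proof. by rewrite /qpoch big_ord0. Qed.

Lemma qpochS c j : qpoch c q j.+1 = qpoch c q j * (1 - c * q ^+ j).
Proof. by rewrite /qpoch big_ord_recr. Qed.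

Lemma qpochD c j k : qpoch c q (j + k) = qpoch c q j * qpoch (c * q ^+ j) q k.
Proof.
elim: k => [|k IH]; first by rewrite addn0 qpoch0 mulr1.
by rewrite addnS !qpochS IH exprD !mulrA.
Qed.

Lemma qpochSl c j : qpoch c q j.+1 = (1 - c) * qpoch (c * q) q j.
Proof. by rewrite -add1n qpochD qpochS qpoch0 expr0 expr1 mul1r mulr1. Qed.

Lemma qfactor_gt0 c k : c < 1 -> 0 < 1 - c * q ^+ k.
Proof.
move=> c1; rewrite subr_gt0; case/andP: (qexp01 hq k) => x0 x1.
have [c0|c0] := leP c 0; first by rewrite (le_lt_trans _ ltr01)// mulr_le0_ge0// ltW.
by rewrite (le_lt_trans _ c1)// ler_piMr// ltW.
Qed.

Lemma qpoch_gt0 c k : c < 1 -> 0 < qpoch c q k.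
Proof. by move=> c1; apply: prodr_gt0 => i _; apply: qfactor_gt0. Qed.

Lemma qpoch_Nn_neq0 n : qpoch (q ^- n) q n != 0.
Proof.
apply/prodf_neq0 => i _; rewrite subr_eq0 eq_sym.
apply/eqP => h; have : q ^+ i = q ^+ n.
  by rewrite -[q ^+ n]mulr1 -h mulrA divff ?mul1r// expf_neq0// gt_eqF.
by move/(qexp_inj hq) => e; have := ltn_ord i; rewrite e ltnn.
Qed.

Lemma qpoch_qexp_eq0 n m : (m < n)%N -> qpoch (q ^- m) q n = 0.
Proof.
move=> mn; rewrite /qpoch (bigD1 (Ordinal mn))//= mulVf ?subrr ?mul0r//.
by rewrite expf_neq0// gt_eqF.
Qed.

(** Both sides satisfy F_(n+1)(y) = (1 - y q^(-n-1)) F_n(y). *)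
Lemma q_binomial n y :
  \sum_(j < n.+1) qpoch (q ^- n) q j / qpoch q q j * y ^+ j = qpoch (y * q ^- n) q n.
Proof.
have qn0 m : q ^+ m != 0 by rewrite expf_neq0// gt_eqF.
have qq0 m : qpoch q q m != 0 by rewrite gt_eqF// qpoch_gt0.
have qf m : 1 - q * q ^+ m != 0 by rewrite gt_eqF// qfactor_gt0.
elim: n => [|n IH]; first by rewrite big_ord1 !qpoch0 expr0 mulr1 divr1.
have qSn : q ^- n.+1 * q = q ^- n.
  by rewrite exprS; field; rewrite qn0 gt_eqF.
rewrite qpochSl -[y * _ * q]mulrA qSn -IH big_ord_recl /bump /=.
have -> : \sum_(i < n.+1)
    qpoch (q ^- n.+1) q (1 + i) / qpoch q q (1 + i) * y ^+ (1 + i) =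
  \sum_(i < n.+1) qpoch (q ^- n) q i.+1 / qpoch q q i.+1 * y ^+ i.+1
  - y * q ^- n.+1 * \sum_(i < n.+1) qpoch (q ^- n) q i / qpoch q q i * y ^+ i.
  rewrite mulr_sumr -sumrB; apply: eq_bigr => i _.
  rewrite add1n (qpochSl (q ^- n.+1)) qSn.
  rewrite [qpoch (q ^- n) q i.+1]qpochS [qpoch q q i.+1]qpochS.
  rewrite (exprS y) (exprS q n); field.
  by rewrite qn0 qq0 qf gt_eqF.
rewrite mulrBl mul1r addrA; congr (_ - _).
rewrite [in RHS]big_ord_recl /bump /= !qpoch0; congr (_ + _).
by rewrite big_ord_recr/= qpoch_qexp_eq0// !mul0r addr0.
Qed.

(** On the monomial X^l this is [q_binomial] at y = q^(l+1), where the product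
    on the right contains the factor 1 - q^0. *)
Lemma q_binomial_annihilates n (P : {poly R}) : (size P <= n)%N ->
  \sum_(j < n.+1) qpoch (q ^- n) q j / qpoch q q j * q ^+ j * P.[q ^+ j] = 0.
Proof.
move=> sP; under eq_bigr => j _ do rewrite horner_coef mulr_sumr.
rewrite exchange_big big1// => l _.
have -> : \sum_(j < n.+1)
    qpoch (q ^- n) q j / qpoch q q j * q ^+ j * (P`_l * (q ^+ j) ^+ l) =
  P`_l * \sum_(j < n.+1) qpoch (q ^- n) q j / qpoch q q j * (q ^+ l.+1) ^+ j.
  rewrite mulr_sumr; apply: eq_bigr => j _.
  rewrite -!exprM mulSn exprD [(l * j)%N]mulnC; ring.
have ln := leq_trans (ltn_ord l) sP.
rewrite q_binomial -(subnKC ln) exprD invfM mulrA divff ?expf_neq0 ?gt_eqF//.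
by rewrite mul1r qpoch_qexp_eq0 ?mulr0// addSn ltnS leq_addl.
Qed.

Lemma horner_qpoch c m y :
  (qpoch (c *: 'X) q%:P m).[y] = qpoch (c * y) q m.
Proof.
rewrite /qpoch horner_prod; apply: eq_bigr => i _.
by rewrite hornerD hornerN hornerM hornerZ hornerX hornerC horner_exp hornerC.
Qed.

Lemma size_qpoch c m : (size (qpoch (c *: 'X) q%:P m : {poly R}) <= m.+1)%N.
Proof.
elim: m => [|m IH]; first by rewrite /qpoch big_ord0 size_poly1.
rewrite /qpoch big_ord_recr /=; apply: leq_trans (size_polyMleq _ _) _.
rewrite -/(qpoch _ _ _).
set s := size ((1 - _)%R : {poly R}); have s2 : (s <= 2)%N.
  apply: leq_trans (size_polyD _ _) _; rewrite size_poly1 size_polyN geq_max/=.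
  rewrite -polyC_exp mulrC mul_polyC; do 2! apply: leq_trans (size_scale_leq _ _) _.
  by rewrite size_polyX.
by move: (size _) s s2 IH => x s; clear; lia.
Qed.

End QPochhammer.

(** * Orthogonality of the little q-Jacobi polynomials *)

Section LittleJacobi.
Variables (R : realType) (q : R).
Hypothesis hq : 0 < q < 1.
Implicit Types (a b : R) (n m j k : nat).

Let q0 : 0 < q. Proof. by case/andP: hq. Qed.
Let q1 : q < 1. Proof. by case/andP: hq. Qed.

Definition jacobi_weight a b k : R :=
  (a * q) ^+ k * qpoch (b * q) q k / qpoch q q k.

Lemma jacobi_weightS a b k : jacobi_weight a b k.+1 =
  jacobi_weight a b k * (a * (1 - b * q * q ^+ k) * (q / (1 - q * q ^+ k))).
Proof.
rewrite /jacobi_weight exprS !qpochS; field.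
by rewrite !gt_eqF// ?qfactor_gt0 ?qpoch_gt0.
Qed.

Section Weight.
Variables a b : R.
Hypotheses (haq : 0 < a * q < 1) (hbq : b * q < 1).
Let w := jacobi_weight a b.
Let aq0 : 0 < a * q. Proof. by case/andP: haq. Qed.
Let aq1 : a * q < 1. Proof. by case/andP: haq. Qed.

Lemma jacobi_weight_gt0 k : 0 < w k.
Proof. by rewrite /w divr_gt0 ?mulr_gt0 ?exprn_gt0 ?qpoch_gt0. Qed.

(** The ratio of consecutive weights tends to aq < 1. *)
Lemma jacobi_weight_summable : cvgn (series w).
Proof.
pose r := (1 + a * q) / 2.
have [r0 [ar r1]] : 0 < r /\ a * q < r /\ r < 1.
  by move: aq0 aq1; rewrite /r; move: (a * q) => x *; lra.
pose d := `|a * q * (b * q)| + r * q + 1.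
have d0 : 0 < d by rewrite ltr_wpDl// addr_ge0// mulr_ge0// ltW.
have rd : 0 < (r - a * q) / d by rewrite divr_gt0// subr_gt0.
have [K Ke] := exists_qexp_lt hq rd.
apply: (@ratio_test _ w r K); first by rewrite r0.
  by move=> k; apply/ltW/jacobi_weight_gt0.
move=> k Kk; rewrite /w jacobi_weightS mulrC ler_pM2r ?jacobi_weight_gt0//.
have xK : q ^+ k * d < r - a * q.
  by rewrite -ltr_pdivlMr// (le_lt_trans _ Ke)// ler_iXn2l.
have x0 : 0 < q ^+ k by rewrite exprn_gt0.
rewrite mulrA ler_pdivrMr ?qfactor_gt0//.
apply: le_trans (_ : a * q + q ^+ k * `|a * q * (b * q)| <= _).
  have := ler_norm (- (a * q * (b * q))); rewrite normrN => h.
  have -> : a * (1 - b * q * q ^+ k) * q = a * q + q ^+ k * - (a * q * (b * q)).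
    by ring.
  by rewrite lerD2l ler_pM2l.
by move: xK; rewrite /d !mulrDr mulr1 mulrN; lra.
Qed.

Let wc := jacobi_weight_summable.
Let w0 := jacobi_weight_gt0.

(** The discrete substitute for integration by parts: the boundary term at the
    point q^0 = 1 is absent when f(1) = 0. *)
Lemma qint_shift f g : f.[1] = 0 ->
  (forall k, w k.+1 * f.[q ^+ k.+1] = w k * g.[q ^+ k]) ->
  qint q w f = qint q w g.
Proof.
move=> f0 fg; apply: cvg_lim => //.
have : cvgn (series (fun k => w k * g.[q ^+ k])) by apply: qint_cvg.
rewrite /qint => cg; rewrite -cvg_shiftS.
suff -> : [sequence series (fun k => w k * f.[q ^+ k]) k.+1]_k
  = series (fun k => w k * g.[q ^+ k]) by exact: cg.
apply/funext => m; rewrite /series /= big_nat_recl// expr0 f0 mulr0 add0r.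
by apply: eq_bigr => i _; rewrite fg.
Qed.

Lemma abqq_lt1 : a * b * q ^+ 2 < 1.
Proof.
have -> : a * b * q ^+ 2 = (a * q) * (b * q) by ring.
have [b0|b0] := leP (b * q) 0.
  by apply: le_lt_trans ltr01; rewrite mulr_ge0_le0// ltW.
by rewrite (lt_trans _ hbq)// gtr_pMl.
Qed.

(** The recurrence of the weights, applied to f = (1 - x) x^m, gives
    (1 - abq^(m+2)) mu_(m+1) = (1 - aq^(m+1)) mu_m. *)
Lemma moment m : qint q w 'X^m =
  qint q w 1 * (qpoch (a * q) q m / qpoch (a * b * q ^+ 2) q m).
Proof.
elim: m => [|m IH]; first by rewrite expr0 !qpoch0 divr1 mulr1.
have D0 k : 0 < 1 - a * b * q ^+ 2 * q ^+ k by rewrite qfactor_gt0// abqq_lt1.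
pose f : {poly R} := 'X^m - 'X^(m.+1).
pose g : {poly R} := (a * q ^+ m.+1) *: ('X^m - (b * q) *: 'X^(m.+1)).
have : qint q w f = qint q w g.
  apply: qint_shift => [|k]; rewrite /f /g.
    by rewrite hornerD hornerN !hornerXn !expr1n subrr.
  rewrite hornerZ !(hornerD, hornerN, hornerZ, hornerXn) /w jacobi_weightS.
  rewrite !exprS !exprMn; field.
  by rewrite gt_eqF// qfactor_gt0.
rewrite /f /g -scaleN1r !(qintD, qintZ)// -[- (_ *: _)]scaleN1r !qintZ// mulN1r => h.
have {}h : qint q w 'X^(m.+1) * (1 - a * b * q ^+ 2 * q ^+ m)
         = (1 - a * q * q ^+ m) * qint q w 'X^m.
  by move: h; rewrite (exprS q m); move: (qint _ _ _) (qint _ _ _) => u v h; lra.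
rewrite !qpochS -(mulfK (lt0r_neq0 (D0 m)) (qint q w 'X^(m.+1))) h IH; field.
by rewrite !gt_eqF// qpoch_gt0// abqq_lt1.
Qed.

(** In the integral of p_n x^m, the quotient of the q-Pochhammer symbols
    coming from the coefficients and from the moments is a polynomial [P] in
    q^j of degree m + (n - 1 - m) < n, so [q_binomial_annihilates] applies. *)
Lemma jacobi_orthogonal n : orthogonal_poly q w n (little_qJacobi q n a b).
Proof.
have D1 k : a * b * q ^+ 2 * q ^+ k < 1.
  by rewrite -subr_gt0 qfactor_gt0// abqq_lt1.
have pE : little_qJacobi q n a b = \poly_(j < n.+1)
    (qpoch (q ^- n) q j * qpoch (a * b * q ^+ n.+1) q j
       / (qpoch (a * q) q j * qpoch q q j) * q ^+ j).
  by rewrite poly_def; apply: eq_bigr => j _; rewrite exprZn scalerA.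
split.
  rewrite pE size_poly_eq// !mulf_neq0 ?qpoch_Nn_neq0 ?invr_neq0 ?mulf_neq0//.
  - case: (n) => [|l]; first by rewrite qpoch0 oner_neq0.
    by rewrite gt_eqF// qpoch_gt0//; have := D1 l; rewrite -mulrA -exprD.
  - by rewrite gt_eqF// qpoch_gt0.
  - by rewrite gt_eqF// qpoch_gt0.
  - by rewrite expf_neq0// gt_eqF.
suff H m : (m < n)%N -> qint q w (little_qJacobi q n a b * 'X^m) = 0.
  move=> g sg; rewrite -[g]coefK poly_def mulr_sumr qint_sum// big1// => i _.
  by rewrite -scalerAr qintZ// H ?mulr0// (leq_trans (ltn_ord i)).
move=> mn; rewrite pE poly_def mulr_suml qint_sum//.
(* The first factor is (aq)_(j+m) / (aq)_j at X = q^j, and the second one,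
   divided by (abq^2)_(n-1), is (abq^(n+1))_j / (abq^2)_(j+m). *)
pose P : {poly R} := qpoch ((a * q) *: 'X) q%:P m *
   qpoch ((a * b * q ^+ 2 * q ^+ m) *: 'X) q%:P (n.-1 - m).
rewrite (eq_bigr (fun j : 'I_n.+1 =>
   qint q w 1 / qpoch (a * b * q ^+ 2) q n.-1 *
   (qpoch (q ^- n) q j / qpoch q q j * q ^+ j * P.[q ^+ j]))); last first.
  move=> j _; rewrite -scalerAl -exprD qintZ// moment /P hornerM !horner_qpoch.
  have e1 := qpochD q (a * b * q ^+ 2) n.-1 j.
  have e2 := qpochD q (a * b * q ^+ 2) (j + m) (n.-1 - m).
  have ee : (n.-1 + j = j + m + (n.-1 - m))%N by clear -mn; lia.
  have e3 : a * b * q ^+ 2 * q ^+ n.-1 = a * b * q ^+ n.+1.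
    by case: (n) mn => // l _; rewrite -mulrA -exprD.
  have e4 : a * b * q ^+ 2 * q ^+ m * q ^+ j = a * b * q ^+ 2 * q ^+ (j + m).
    by rewrite exprD; ring.
  rewrite e4 (qpochD q (a * q)).
  move: e1; rewrite e3 ee e2.
  have : 0 < qpoch (a * b * q ^+ 2) q (j + m) by rewrite qpoch_gt0// abqq_lt1.
  have : 0 < qpoch (a * b * q ^+ 2) q n.-1 by rewrite qpoch_gt0// abqq_lt1.
  have : 0 < qpoch q q j by rewrite qpoch_gt0.
  have : 0 < qpoch (a * q) q j by rewrite qpoch_gt0.
  move: (qpoch (a * b * q ^+ n.+1) q j) (qpoch _ q (j + m)) (qpoch _ q n.-1).
  move=> u v x A0 Q0 x0 v0 e.
  have -> : u = v * qpoch (a * b * q ^+ 2 * q ^+ (j + m)) q (n.-1 - m) / x.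
    by rewrite e mulrAC divff ?mul1r// gt_eqF.
  by field; rewrite !gt_eqF.
rewrite -mulr_sumr q_binomial_annihilates ?mulr0// /P.
apply: leq_trans (size_polyMleq _ _) _.
have := size_qpoch q (a * q) m.
have := size_qpoch q (a * b * q ^+ 2 * q ^+ m) (n.-1 - m).
by move: (size _) (size _) => x y; clear -mn; lia.
Qed.

End Weight.
End LittleJacobi.

(** * Interlacing of the little q-Jacobi polynomials *)

Section Assembly.
Variables (R : realType) (q : R).
Hypothesis hq : 0 < q < 1.

Let q0 : 0 < q. Proof. by case/andP: hq. Qed.
Let q1 : q < 1. Proof. by case/andP: hq. Qed.

(** The factors depending on k alone are common to the two weights; what
    remains of a step of the ratio is the comparison of [s] and [t]. *)
Lemma jacobi_ratio_step (a1 b1 a2 b2 : R) (M N : {poly R}) k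
    (rho := fun k => (M.[q ^+ k] ^+ 2 * jacobi_weight q a1 b1 k)
                     / (N.[q ^+ k] ^+ 2 * jacobi_weight q a2 b2 k)) :
  0 < a1 * q < 1 -> b1 * q < 1 -> 0 < a2 * q < 1 -> b2 * q < 1 ->
  (forall j, N.[q ^+ j] != 0) ->
  let s := M.[q ^+ k.+1] ^+ 2 * N.[q ^+ k] ^+ 2 * (a1 * (1 - b1 * q * q ^+ k)) in
  let t := M.[q ^+ k] ^+ 2 * N.[q ^+ k.+1] ^+ 2 * (a2 * (1 - b2 * q * q ^+ k)) in
  (s <= t -> rho k.+1 <= rho k) * (s < t -> rho k.+1 < rho k).
Proof.
move=> ha1 hb1 ha2 hb2 N0 s t; have [ha20 _] := andP ha2.
have b2k : 0 < 1 - b2 * q * q ^+ k by rewrite qfactor_gt0.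
have e0 : 0 < 1 - q * q ^+ k by rewrite qfactor_gt0.
have a20 : 0 < a2 by rewrite -(pmulr_lgt0 _ q0).
have W1 := jacobi_weight_gt0 hq ha1 hb1 k.
have W2 := jacobi_weight_gt0 hq ha2 hb2 k.
have Nk j : 0 < N.[q ^+ j] ^+ 2 by rewrite exprn_even_gt0/=.
pose c := jacobi_weight q a1 b1 k / (jacobi_weight q a2 b2 k
  * (N.[q ^+ k] ^+ 2 * N.[q ^+ k.+1] ^+ 2 * (a2 * (1 - b2 * q * q ^+ k)))).
have c0 : 0 < c.
  by rewrite divr_gt0//; apply: mulr_gt0 => //; apply: mulr_gt0; apply: mulr_gt0.
have -> : rho k.+1 = c * s.
  rewrite /rho !jacobi_weightS// /c /s.
  move: (jacobi_weight _ _ _ _) (jacobi_weight _ _ _ _) W1 W2 => w1 w2 W1 W2.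
  by field; rewrite !N0 !gt_eqF.
have -> : rho k = c * t.
  rewrite /rho /c /t.
  move: (jacobi_weight _ _ _ _) (jacobi_weight _ _ _ _) W1 W2 => w1 w2 W1 W2.
  by field; rewrite !N0 !gt_eqF.
by split; rewrite (ler_pM2l, ltr_pM2l).
Qed.

(** The hypotheses of [zeros_lt] as an inequality between polynomials in
    x = q^k, where q x is the next point. *)
Lemma jacobi_zeros_lt (n d i : nat) (a1 b1 a2 b2 : R) (M N : {poly R}) (al be : seq R) :
  0 < a1 * q < 1 -> b1 * q < 1 -> 0 < a2 * q < 1 -> b2 * q < 1 ->
  zeros_listing n (little_qJacobi q n a1 b1) al -> sorted <%R al ->
  zeros_listing n (little_qJacobi q n a2 b2) be -> sorted <%R be ->
  all (fun z => 0 < z < 1) al -> all (fun z => 0 < z < 1) be ->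
  (size M <= d.+1)%N -> (size N <= d.+1)%N ->
  (forall x, 0 < x <= 1 -> M.[x] != 0) -> (forall x, 0 < x <= 1 -> N.[x] != 0) ->
  let s x := M.[q * x] ^+ 2 * N.[x] ^+ 2 * (a1 * (1 - b1 * q * x)) in
  let t x := M.[x] ^+ 2 * N.[q * x] ^+ 2 * (a2 * (1 - b2 * q * x)) in
  (forall x, 0 < x <= 1 -> s x <= t x) ->
  (0 < d)%N \/ (forall x, 0 < x <= 1 -> s x < t x) ->
  (i + d < n)%N -> be`_i < al`_(i + d).
Proof.
move=> ha1 hb1 ha2 hb2 z1 s1 z2 s2 al01 be01 sM sN M0 N0 s t st sst idn.
have Nk k : N.[q ^+ k] != 0 by rewrite N0// qexp01.
have step k := jacobi_ratio_step M k ha1 hb1 ha2 hb2 Nk.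
apply: (zeros_lt hq (jacobi_weight_gt0 hq ha1 hb1) (jacobi_weight_summable hq ha1 hb1)
  (jacobi_weight_gt0 hq ha2 hb2) (jacobi_weight_summable hq ha2 hb2)
  (jacobi_orthogonal hq ha1 hb1 n) z1 s1 (jacobi_orthogonal hq ha2 hb2 n) z2 s2
  sM sN) => // [k|].
  by apply: (step k).1; rewrite (exprS q k); apply: st; apply: qexp01.
case: sst => [d0|lt]; [right; split=> //|left=> k].
  by apply/allP => z /(allP al01) /andP[z0 /ltW z1']; rewrite M0// z0.
by apply: (step k).2; rewrite (exprS q k); apply: lt; apply: qexp01.
Qed.

Lemma jacobi_zeros (n : nat) (a b : R) : 0 < a * q < 1 -> b * q < 1 ->
  exists s, [/\ zeros_listing n (little_qJacobi q n a b) s, sorted <%R s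
    & all (fun z => 0 < z < 1) s].
Proof.
move=> ha hb; apply: (orthogonal_poly_zeros hq (jacobi_weight_gt0 hq ha hb)).
  exact: jacobi_weight_summable.
exact: jacobi_orthogonal.
Qed.

(** The strict inequality says that the quotient of the two weights is
    monotone, which orders zeros of equal rank; the inequality with M and N
    bounds how far the zeros can move. *)
Lemma jacobi_interlace (n : nat) (a1 b1 a2 b2 : R) (M N : {poly R}) :
  0 < a1 * q < 1 -> b1 * q < 1 -> 0 < a2 * q < 1 -> b2 * q < 1 ->
  (size M <= 2)%N -> (size N <= 2)%N ->
  (forall x, 0 < x <= 1 -> M.[x] != 0) -> (forall x, 0 < x <= 1 -> N.[x] != 0) ->
  (forall x, 0 < x <= 1 -> a2 * (1 - b2 * q * x) < a1 * (1 - b1 * q * x)) ->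
  (forall x, 0 < x <= 1 ->
    M.[q * x] ^+ 2 * N.[x] ^+ 2 * (a1 * (1 - b1 * q * x))
      <= M.[x] ^+ 2 * N.[q * x] ^+ 2 * (a2 * (1 - b2 * q * x))) ->
  strictly_interlaces n (little_qJacobi q n a1 b1) (little_qJacobi q n a2 b2).
Proof.
move=> ha1 hb1 ha2 hb2 sM sN M0 N0 lt le.
have [s [zs ss s01]] := jacobi_zeros n ha1 hb1.
have [t [zt st t01]] := jacobi_zeros n ha2 hb2.
have one0 (x : R) : 0 < x <= 1 -> (1 : {poly R}).[x] != 0 by rewrite hornerC oner_neq0.
exists s, t; split=> // i ni; last first.
  rewrite -[i.+1]addn1.
  apply: (@jacobi_zeros_lt n 1 i _ _ _ _ M N s t ha1 hb1 ha2 hb2) => //.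
    by left.
  by rewrite addn1.
rewrite -[in t`_i](addn0 i).
apply: (@jacobi_zeros_lt n 0 i _ _ _ _ 1 1 t s ha2 hb2 ha1 hb1) => //;
  rewrite ?size_poly1 ?addn0//.
- by move=> x x01; rewrite !hornerC expr1n !mul1r ltW// lt.
- by right=> x x01; rewrite !hornerC expr1n !mul1r lt.
Qed.

End Assembly.

Theorem corollary3p3 (R : realType) (q : R) (n : nat) (a b t1 t2 : R)
    (hq : 0 < q < 1) (haq : 0 < a * q < 1)
    (ht1 : q ^+ 2 <= t1 <= 1) (ht2 : q ^+ 2 <= t2 <= 1)
    (ht : t1 * t2 <> 1) :
  (0 <= q * b < 1 -> ~ (b = 0 /\ t2 = 1) ->
     strictly_interlaces n (little_qJacobi q n a (t1 * b))
                           (little_qJacobi q n (t2 * a) b))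
  /\
  (b < 0 -> t1 <> 1 ->
     strictly_interlaces n (little_qJacobi q n a b)
                           (little_qJacobi q n a (t1 * b))).
Proof.
have [q0 q1] := andP hq; have [aq0 aq1] := andP haq.
have [t1q t11] := andP ht1; have [t2q t21] := andP ht2.
have qq0 : 0 < q ^+ 2 by rewrite exprn_gt0.
have t10 : 0 < t1 := lt_le_trans qq0 t1q.
have t20 : 0 < t2 := lt_le_trans qq0 t2q.
have a0 : 0 < a by rewrite -(pmulr_lgt0 _ q0).
have hornerN1 c x : (1 - c *: 'X : {poly R}).[x] = 1 - c * x.
  by rewrite hornerD hornerN hornerZ hornerX hornerC.
have sN c : (size (1 - c *: 'X : {poly R})%R <= 2)%N.
  apply: leq_trans (size_polyD _ _) _; rewrite size_poly1 size_polyN geq_max/=.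
  by apply: leq_trans (size_scale_leq _ _) _; rewrite size_polyX.
have yx x : 0 < x <= 1 -> b * q < 1 -> b * q * x < 1.
  move=> /andP[x0 x1] h; have [b0|b0] := leP (b * q) 0.
    by apply: le_lt_trans ltr01; rewrite mulr_le0_ge0// ltW.
  by rewrite (le_lt_trans _ h)// ler_piMr// ltW.
have N0 : b * q < 1 -> forall x, 0 < x <= 1 -> (1 - (b * q) *: 'X : {poly R}).[x] != 0.
  by move=> h x x01; rewrite hornerN1 gt_eqF// subr_gt0 yx.
have x_gt0 x : 0 < x <= 1 -> (0 < x) by case/andP.
have t1y x : t1 * b * q * x = t1 * (b * q * x) by ring.
have qy x : b * q * (q * x) = q * (b * q * x) by ring.
split=> [/andP[qb0 qb1] nb|b0 t1n].
- have bq1 : b * q < 1 by rewrite mulrC.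
  have bq0 : 0 <= b * q by rewrite mulrC.
  apply: (@jacobi_interlace R q hq n _ _ _ _ 'X (1 - (b * q) *: 'X)) => //.
  + by rewrite -mulrA (le_lt_trans _ bq1)// ler_piMl.
  + by rewrite -mulrA mulr_gt0//= (le_lt_trans _ aq1)// ler_piMl// ltW.
  + by rewrite size_polyX.
  + by move=> x /x_gt0 x0; rewrite hornerX gt_eqF.
  + exact: N0.
  + move=> x x01; have y1 := yx x x01 bq1.
    have y0 : 0 <= b * q * x by rewrite mulr_ge0// ltW// x_gt0.
    have -> : t2 * a * (1 - b * q * x) = a * (t2 * (1 - b * q * x)) by ring.
    rewrite ltr_pM2l// t1y.
    move: (t21); rewrite le_eqVlt => /predU1P[t2e|t2l]; last first.
      apply: (@lt_le_trans _ _ (1 - b * q * x)).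
        by rewrite gtr_pMl// subr_gt0.
      by rewrite lerD2l lerN2 ler_piMl.
    have t1l : t1 < 1.
      by rewrite lt_neqAle t11 andbT; apply/eqP => e; apply: ht; rewrite e t2e mulr1.
    rewrite t2e mul1r ltrD2l ltrN2 gtr_pMl//.
    rewrite lt_neqAle y0 andbT eq_sym !mulf_eq0 (gt_eqF q0) (gt_eqF (andP x01).1).
    by rewrite !orbF; apply/eqP => b0; apply: nb.
  + move=> x x01; have y1 := yx x x01 bq1.
    have y0 : 0 <= b * q * x by rewrite mulr_ge0// ltW// x_gt0.
    rewrite !hornerX !hornerN1 t1y qy.
    move: (b * q * x) y0 y1 => y y0 y1.
    have -> : (q * x) ^+ 2 * (1 - y) ^+ 2 * (a * (1 - t1 * y)) =
      x ^+ 2 * (a * (1 - y)) * (q ^+ 2 * ((1 - y) * (1 - t1 * y))) by ring.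
    have -> : x ^+ 2 * (1 - q * y) ^+ 2 * (t2 * a * (1 - y)) =
      x ^+ 2 * (a * (1 - y)) * (t2 * (1 - q * y) ^+ 2) by ring.
    have y10 : 0 <= 1 - y by rewrite subr_ge0 ltW.
    apply: ler_wpM2l; first by apply: mulr_ge0 (sqr_ge0 _) (mulr_ge0 (ltW a0) y10).
    apply: (@le_trans _ _ (q ^+ 2 * (1 - q * y) ^+ 2)); last first.
      by apply: ler_wpM2r => //; apply: sqr_ge0.
    rewrite ler_pM2l//; apply: (@le_trans _ _ ((1 - y) * (1 - q ^+ 2 * y))).
      by apply: ler_wpM2l => //; rewrite lerD2l lerN2 ler_wpM2r.
    rewrite -subr_ge0.
    (* The value t1 = q^2 is extremal; there the gap is a multiple of a square. *)
    have -> : (1 - q * y) ^+ 2 - (1 - y) * (1 - q ^+ 2 * y) = y * (1 - q) ^+ 2 by ring.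
    by rewrite mulr_ge0 ?sqr_ge0.
- have bq0 : b * q < 0 by rewrite nmulr_rlt0.
  have bq1 : b * q < 1 := lt_trans bq0 ltr01.
  have tb1 : t1 * b * q < 1.
    by rewrite -mulrA (lt_trans _ ltr01)// pmulr_rlt0.
  apply: (@jacobi_interlace R q hq n _ _ _ _ (1 - (b * q) *: 'X) 1) => //.
  + by rewrite size_poly1.
  + exact: N0.
  + by move=> x _; rewrite hornerC oner_neq0.
  + move=> x x01; rewrite ltr_pM2l// t1y ltrD2l ltrN2.
    rewrite -subr_gt0 -{2}(mul1r (b * q * x)) -mulrBl nmulr_rgt0.
      by rewrite nmulr_rlt0// x_gt0.
    by rewrite subr_lt0 lt_neqAle t11 andbT; apply/eqP.
  + move=> x x01.
    have y0 : b * q * x < 0 by rewrite nmulr_rlt0// x_gt0.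
    rewrite !hornerC !hornerN1 t1y qy !expr1n.
    move: (b * q * x) y0 => y y0.
    have -> : (1 - q * y) ^+ 2 * 1 * (a * (1 - y)) =
      a * (1 - y) * (1 - q * y) ^+ 2 by ring.
    have -> : (1 - y) ^+ 2 * 1 * (a * (1 - t1 * y)) =
      a * (1 - y) * ((1 - y) * (1 - t1 * y)) by ring.
    have y1 : 0 < 1 - y by rewrite subr_gt0 (lt_trans y0).
    rewrite ler_pM2l ?mulr_gt0//.
    apply: (@le_trans _ _ ((1 - y) * (1 - q ^+ 2 * y))); last first.
      by rewrite ler_pM2l// lerD2l lerN2 ler_wnM2r// ltW.
    rewrite -subr_ge0.
    have -> : (1 - y) * (1 - q ^+ 2 * y) - (1 - q * y) ^+ 2 = (- y) * (1 - q) ^+ 2.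
      by ring.
    by rewrite mulr_ge0 ?sqr_ge0// oppr_ge0 ltW.
Qed.
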